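(* Let $K$ be a field of characteristic $0$, let $(r,s)\in\mathbb{Z}^2$ with $r\neq 0$ and $\nu=r+s>0$, and let $L=K(\beta)$ with $\beta$ an indeterminate. For $k\ge 0$ put $d'_k=(\nu/r)^k\prod_{i=0}^{k-1}(\nu^{-1}-i)$ (so $d'_0=1$). For integers $i\le 1$ define $\eta_i\in\mathrm{End}_{K\text{-lin}}(L)$ by $$\eta_i=\begin{cases}\dfrac{d'_k}{k!}\left(\dfrac{d}{d\beta}\right)^k, & i=1-k\nu\text{ with }k\ge 0,\\[2mm] 0,& i\not\equiv 1\ (\mathrm{mod}\ \nu).\end{cases}$$ Then the operators $\eta_i$, $i\in\mathbb{Z}_{\le 0}$, satisfy, for all $i\le 0$ and $a,b\in L$, $$\eta_i(ab)=a\,\eta_i(b)+\eta_i(a)\,b+\sum_{k>0}\ \sum_{\substack{l,j_1,\dots,j_k\in\mathbb{Z}_{\le 0}\\ j_1+\cdots+j_k-k+l=i}}\binom{l}{k}\,\eta_l(a)\,\eta_{j_1}\cdots\eta_{j_k}(b),$$ so there exists a multiplication $\tilde\eta$ on $L_{\mathbf r}((T^{-1}))$ such that $$f\cdot T=T\cdot f+\sum_{k=1}^\infty T^{1-k\nu}\cdot\eta_{1-k\nu}(f)=T\cdot f+r^{-1}T^{1-\nu}f'+\frac{1}{2!}\frac{1-\nu}{r^2}T^{1-2\nu}f^{(2)}+\cdots,\qquad f\in L,$$ and $L_{\mathbf r}((T^{-1};\tilde\eta))$ is a right deformed Laurent series ring, with multiplication $$\sum_{i\le m}T^ia_i\cdot\sum_{j\le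 n}T^jb_j=\sum_{i\le m,\,j\le n}T^ia_i\cdot T^jb_j,\qquad T^ia_i\cdot T^jb_j=\sum_{k\ge 0}\lambda_j^k\,T^{j-k\nu+i}\,a_i^{(k)}\,b_j,$$ where $\lambda_j^0=1$ and, for $k>0$, $$\lambda_j^k=\left(\frac{\nu}{r}\right)^k\sum_{l=1}^k(-1)^{k-l}\binom{j}{l}\binom{j-l-1}{k-l}\binom{l\nu^{-1}}{k}.$$
   Context: For a field $L$, $L_{\mathbf r}((T^{-1}))=\{\sum_{i\le k}T^ia_i : a_i\in L,\ k\in\mathbb{Z}\}$ is the right $L$-vector space of (inverse) formal Laurent series. The standard degree map is $\deg_r 0=-\infty$, $\deg_r(\sum_{i\le k}T^ia_i)=k$ if $a_k\ne 0$. The topology is induced by the metric $d(f,g)=e^{\deg_r(f-g)}$. A right deformed Laurent series ring (with the standard degree map) $L_{\mathbf r}((T^{-1};\tilde\eta))$ is $L_{\mathbf r}((T^{-1}))$ with its usual addition, standard degree map and topology, together with a multiplication $\tilde\eta:(f,g)\mapsto f\cdot g$ such that: (i) the multiplication is associative, distributive over addition, and continuous; (ii) $\big(\sum_{i\le k}T^ia_i\big)\cdot b=\sum_{i\le k}T^i(a_ib)$ for $b\in L$; (iii) $T^i\cdot T^j=T^{i+j}$ for $i,j\in\mathbb{Z}$ (with $T^0=1$); (iv) $\deg_r(f\cdot g)=\deg_r f+\deg_r g$ for all $f,g$. For a rational number $a$ and integer $k\ge 0$, $\binom{a}{k}=a(a-1)\cdots(a-k+1)/k!$, with $\binom a0=1$.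 $f^{(k)}$ is the $k$-th derivative of $f\in K(\beta)$ with respect to $\beta$. In $\lambda_j^k$ the $k$ is a superscript index, not an exponent. *)

(* Defs.v *)
From HB Require Import structures.
From mathcomp Require Import all_boot all_order all_algebra.
From mathcomp Require Import fraction ring zify.
From mathcomp Require Import all_classical all_reals all_analysis.
From mathcomp Require Import Rstruct.
From mathcomp Require summability.

Set Implicit Arguments.
Unset Strict Implicit.
Unset Printing Implicit Defensive.

Import Order.TTheory GRing.Theory Num.Theory.
Local Open Scope classical_set_scope.
Local Open Scope ring_scope.

(* [Laurent a _] is the formal series \sum_(i <= k) T^i a_i. *)
Record laurent (L : fieldType) := Laurent {
  coef :> int -> L;
  coefP : exists k : int, forall i, k < i -> coef i = 0 }.

Section LaurentGroup.
Variable L : fieldType.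
Implicit Types f g h : laurent L.

Lemma laurentP f g : (forall i, f i = g i) -> f = g.
Proof.
case: f g => [a aP] [b bP] /= /funext ab; subst b.
by congr Laurent; exact: Prop_irrelevance.
Qed.

HB.instance Definition _ := gen_eqMixin (laurent L).
HB.instance Definition _ := gen_choiceMixin (laurent L).

Definition lzero : laurent L.
Proof. by exists (fun=> 0); exists 0. Defined.

Definition lopp f : laurent L.
Proof.
by exists (fun i => - f i); have [k fk] := coefP f; exists k => i /fk ->;
  rewrite oppr0.
Defined.

Definition ladd f g : laurent L.
Proof.
exists (fun i => f i + g i); have [[k fk] [l gl]] := (coefP f, coefP g).
by exists (Num.max k l) => i; rewrite gt_max => /andP[/fk -> /gl ->]; rewrite addr0.
Defined.

Lemma laddA : associative ladd.
Proof. by move=> f g h; apply: laurentP => i /=; rewrite addrA. Qed.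

Lemma laddC : commutative ladd.
Proof. by move=> f g; apply: laurentP => i /=; rewrite addrC. Qed.

Lemma ladd0 : left_id lzero ladd.
Proof. by move=> f; apply: laurentP => i /=; rewrite add0r. Qed.

Lemma laddN : left_inverse lzero lopp ladd.
Proof. by move=> f; apply: laurentP => i /=; rewrite addNr. Qed.

HB.instance Definition _ := GRing.isZmodule.Build (laurent L) laddA laddC ladd0 laddN.

Lemma coef0 i : (0 : laurent L) i = 0. Proof. by []. Qed.
Lemma coefD f g i : (f + g) i = f i + g i. Proof. by []. Qed.
Lemma coefN f i : (- f) i = - f i. Proof. by []. Qed.

(* The monomial T^i a. *)
Definition lmono (i : int) (a : L) : laurent L.
Proof.
by exists (fun j => if j == i then a else 0); exists i => j; case: eqVneq => [->|//];
  rewrite ltxx.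
Defined.

(* The right L-vector space structure, (\sum_i T^i a_i) b = \sum_i T^i (a_i b). *)
Definition rscale f (b : L) : laurent L.
Proof.
by exists (fun i => f i * b); have [k fk] := coefP f; exists k => i /fk ->;
  rewrite mul0r.
Defined.

(* [xget] picks the (unique, by [is_degP]) degree of a nonzero series. *)
Definition is_deg f (k : int) := f k != 0 /\ forall i, k < i -> f i = 0.

Definition deg f : \bar int :=
  if f == 0 then -oo%E else (xget 0 [set k | is_deg f k])%:E.

Lemma is_deg_ex f : f != 0 -> exists k, is_deg f k.
Proof.
move=> f0; have [m fm] := coefP f.
have [j fj] : exists j, f j != 0.
  apply/not_existsP => h; case/eqP: f0; apply: laurentP => j.
  by apply/eqP/negbNE/negP/h.
have jm : j <= m by rewrite leNgt; apply: contra fj => /fm ->.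
have exP : exists n : nat, f (m - n%:Z) != 0.
  by exists `|m - j|%N; rewrite gez0_abs ?subr_ge0// subKr.
case: (ex_minnP exP) => n fn nmin; exists (m - n%:Z); split=> // i mi.
have [/fm//|im] := ltP m i; apply/eqP/negbNE/negP => fi.
have := nmin `|m - i|%N; rewrite gez0_abs ?subr_ge0// subKr.
by move=> /(_ fi); lia.
Qed.

Lemma is_deg_unique f k l : is_deg f k -> is_deg f l -> k = l.
Proof.
move=> [fk hk] [fl hl]; case: (ltgtP k l) => [/hk h|/hl h|//].
  by move: fl; rewrite h eqxx.
by move: fk; rewrite h eqxx.
Qed.

Lemma deg0 : deg 0 = -oo%E. Proof. by rewrite /deg eqxx. Qed.

Lemma degP f k : deg f = k%:E <-> is_deg f k.
Proof.
rewrite /deg; case: eqVneq => [->|f0]; first by split=> // -[]; rewrite eqxx.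
have [l fl] := is_deg_ex f0.
have -> : xget 0 [set k | is_deg f k] = l.
  by case: xgetP => [x _ /= fx|/(_ l)//]; apply: is_deg_unique fx fl.
by split=> [[<-]//|fk]; rewrite (is_deg_unique fk fl).
Qed.

Lemma deg_eq0 f : (deg f == -oo%E) = (f == 0).
Proof. by rewrite /deg; case: ifP. Qed.

Lemma deg_leP f (k : int) :
  (deg f <= k%:E)%E <-> forall i, k < i -> f i = 0.
Proof.
have [->|f0] := eqVneq f 0; first by rewrite deg0 leNye.
have [l fl] := is_deg_ex f0; have -> := (degP f l).2 fl; rewrite lee_fin.
split=> [lk i ki|h]; first by apply: fl.2; exact: le_lt_trans lk ki.
by rewrite leNgt; apply/negP => /h fl0; move: fl.1; rewrite fl0 eqxx.
Qed.

Lemma degN f : deg (- f) = deg f.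
Proof.
have [->|f0] := eqVneq f 0; first by rewrite oppr0.
have [k fk] := is_deg_ex f0; rewrite ((degP f k).2 fk); apply/degP; split=> [|i ki].
  by rewrite coefN oppr_eq0 fk.1.
by rewrite coefN fk.2// oppr0.
Qed.

Lemma deg_leD f g : (deg (f + g)%R <= maxe (deg f) (deg g))%E.
Proof.
have [->|f0] := eqVneq f 0; first by rewrite add0r deg0 le_max lexx orbT.
have [->|g0] := eqVneq g 0; first by rewrite addr0 deg0 le_max lexx.
have [k fk] := is_deg_ex f0; have [l gl] := is_deg_ex g0.
rewrite ((degP f k).2 fk) ((degP g l).2 gl) -EFin_max; apply/deg_leP => i.
by rewrite gt_max => /andP[ki li]; rewrite coefD fk.2// gl.2// addr0.
Qed.

(* e ^ deg f, with the convention e ^ -oo = 0. *)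
Definition labs f : Rdefinitions.R := if deg f is d%:E then expR d%:~R else 0.

Definition ldist f g : Rdefinitions.R := labs (f - g).

Lemma labs_ge0 f : 0 <= labs f.
Proof. by rewrite /labs; case: deg => // d; exact: expR_ge0. Qed.

Lemma labs_le f g : (deg f <= deg g)%E -> labs f <= labs g.
Proof.
rewrite /labs; have : deg g != +oo%E by rewrite /deg; case: ifP.
case: (deg f) (deg g) => [d||] [e||] //= _.
  by rewrite lee_fin ler_expR ler_int.
Qed.

Lemma ldistxx f : ldist f f = 0.
Proof. by rewrite /ldist subrr /labs deg0. Qed.

Lemma ldist_positivity f g : ldist f g = 0 -> f = g.
Proof.
rewrite /ldist /labs /deg; case: eqP => [/eqP|_ /eqP].
  by rewrite subr_eq0 => /eqP.
by rewrite gt_eqF// expR_gt0.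
Qed.

Lemma ldist_sym f g : ldist f g = ldist g f.
Proof. by rewrite /ldist /labs -degN opprB. Qed.

Lemma ldist_triangle g f h : ldist f h <= ldist f g + ldist g h.
Proof.
have : (deg (f - h)%R <= maxe (deg (f - g)%R) (deg (g - h)%R))%E.
  by rewrite (_ : f - h = (f - g) + (g - h)) ?deg_leD// addrA subrK.
rewrite le_max => /orP[] /labs_le /le_trans; apply.
  by rewrite lerDl labs_ge0.
by rewrite lerDr labs_ge0.
Qed.

HB.instance Definition _ := isMetric.Build Rdefinitions.R (laurent L)
  ldistxx ldist_positivity ldist_sym ldist_triangle.

End LaurentGroup.

Notation lconst a := (lmono 0 a).
Notation Tpow i := (lmono i 1).

(* Right deformed Laurent series rings with the standard degree map: the
   multiplication [mul] plays the role of $\tilde\eta$. *)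
Record right_deformed (L : fieldType)
    (mul : laurent L -> laurent L -> laurent L) : Prop := RightDeformed {
  rd_mulA : associative mul;
  rd_mulDl : left_distributive mul +%R;
  rd_mulDr : right_distributive mul +%R;
  rd_continuous : continuous (fun p : laurent L * laurent L => mul p.1 p.2);
  rd_scale : forall f (b : L), mul f (lconst b) = rscale f b;
  rd_Tpow : forall i j, mul (Tpow i) (Tpow j) = Tpow (i + j);
  rd_mul1l : left_id (Tpow 0) mul;
  rd_mul1r : right_id (Tpow 0) mul;
  rd_deg : forall f g, deg (mul f g) = (deg f + deg g)%E }.

(* $K(\beta)$, with $\beta$ the image of 'X. *)
Notation ratfun K := {fraction {poly K}}.

Lemma quotient_ruleD (F : fieldType) (p q n d p' q' n' d' : F) :
  q != 0 -> d != 0 ->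
  ((p' * d + p * d' + (n' * q + n * q')) * (q * d)
     - (p * d + n * q) * (q' * d + q * d')) / (q * d) ^+ 2
  = (p' * q - p * q') / q ^+ 2 + (n' * d - n * d') / d ^+ 2.
Proof. by move=> q0 d0; field; rewrite q0 d0. Qed.

Lemma quotient_ruleM (F : fieldType) (p q n d p' q' n' d' : F) :
  q != 0 -> d != 0 ->
  ((p' * n + p * n') * (q * d) - p * n * (q' * d + q * d')) / (q * d) ^+ 2
  = (p' * q - p * q') / q ^+ 2 * (n / d) + p / q * ((n' * d - n * d') / d ^+ 2).
Proof. by move=> q0 d0; field; rewrite q0 d0. Qed.

Section RatfunDerivative.
Variable K : fieldType.
Local Notation "p %:F" := (@FracField.tofrac {poly K} p).
Implicit Types (x y : ratfun K) (p q n d : {poly K}).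

(* The derivative d/d\beta, computed by the quotient rule on the chosen
   representative; [ratderE] shows that any representative may be used. *)
Definition ratder (x : ratfun K) : ratfun K :=
  let n := (repr x).1 in let d := (repr x).2 in
  (n^`() * d - n * d^`())%:F / (d ^+ 2)%:F.

Lemma ratfun_repr x : x = ((repr x).1)%:F / ((repr x).2)%:F.
Proof.
have d0 : ((repr x).2)%:F != 0 by rewrite tofrac_eq0 denom_ratioP.
apply: (mulIf d0); rewrite divfK// -[X in X * _ = _](reprK x).
unlock FracField.tofrac; rewrite -[LHS]FracField.pi_mul.
apply/eqmodP; rewrite /= FracField.equivfE /FracField.mulf.
by rewrite !numden_Ratio ?mulf_neq0 ?oner_eq0 ?denom_ratioP// !mulr1 mulrC.
Qed.

Lemma ratderE p q : q != 0 ->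
  ratder (p%:F / q%:F) = (p^`() * q - p * q^`())%:F / (q ^+ 2)%:F.
Proof.
move=> q0; rewrite /ratder; set x := p%:F / q%:F.
set n := (repr x).1; set d := (repr x).2.
have d0 : d != 0 by exact: denom_ratioP.
have /eqP := ratfun_repr x; rewrite -/n -/d /x.
rewrite eqr_div ?tofrac_eq0// -!tofracM tofrac_eq => /eqP pdnq.
apply/eqP; rewrite eqr_div ?tofrac_eq0 ?expf_neq0// -!tofracM tofrac_eq.
have := congr1 (@deriv K) pdnq; rewrite !derivM => dpdnq.
apply/eqP.
have -> : (n^`() * d - n * d^`()) * q ^+ 2
        = (n^`() * q + n * q^`()) * q * d - (n * q) * q^`() * d - (n * q) * d^`() * q.
  by ring.
by rewrite -dpdnq -pdnq; ring.
Qed.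

Lemma ratfunP x : exists p q, q != 0 /\ x = p%:F / q%:F.
Proof. by exists (repr x).1, (repr x).2; split; [exact: denom_ratioP|exact: ratfun_repr]. Qed.

Lemma ratderD x y : ratder (x + y) = ratder x + ratder y.
Proof.
have [p [q [q0 ->]]] := ratfunP x; have [n [d [d0 ->]]] := ratfunP y.
have [qF dF] : q%:F != 0 /\ d%:F != 0 by rewrite !tofrac_eq0.
have -> : p%:F / q%:F + n%:F / d%:F = (p * d + n * q)%:F / (q * d)%:F.
  by rewrite (addf_div _ _ qF dF) tofracD !tofracM.
rewrite !ratderE ?mulf_neq0// derivD !derivM.
rewrite !(tofracXn, tofracB, tofracD, tofracM).
by have := quotient_ruleD p%:F n%:F p^`()%:F q^`()%:F n^`()%:F d^`()%:F qF dF.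
Qed.

Lemma ratderM x y : ratder (x * y) = ratder x * y + x * ratder y.
Proof.
have [p [q [q0 ->]]] := ratfunP x; have [n [d [d0 ->]]] := ratfunP y.
have [qF dF] : q%:F != 0 /\ d%:F != 0 by rewrite !tofrac_eq0.
have -> : p%:F / q%:F * (n%:F / d%:F) = (p * n)%:F / (q * d)%:F.
  by rewrite mulf_div !tofracM.
rewrite !ratderE ?mulf_neq0// !derivM.
rewrite !(tofracXn, tofracB, tofracD, tofracM).
by have := quotient_ruleM p%:F n%:F p^`()%:F q^`()%:F n^`()%:F d^`()%:F qF dF.
Qed.

Lemma ratder_poly p : ratder p%:F = p^`()%:F.
Proof.
rewrite -[p%:F]divr1 -tofrac1 ratderE ?oner_eq0// -polyC1 derivC polyC1.
by rewrite mulr0 subr0 mulr1 expr1n tofrac1 divr1.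
Qed.

End RatfunDerivative.

(* The binomial coefficient $\binom{a}{k}$ of a rational number. *)
Definition qbin (a : rat) (k : nat) : rat :=
  (\prod_(i < k) (a - i%:R)) / k`!%:R.

Section Operators.
Variables (r nu : int).

Definition dcoef (k : nat) : rat :=
  (nu%:~R / r%:~R) ^+ k * \prod_(i < k) (nu%:~R^-1 - i%:R).

(* $\lambda_j^k$ *)
Definition lam (j : int) (k : nat) : rat :=
  if k == 0%N then 1 else
  (nu%:~R / r%:~R) ^+ k *
  \sum_(1 <= l < k.+1)
    (-1) ^+ (k - l) * qbin j%:~R l * qbin (j%:~R - l%:R - 1) (k - l)
    * qbin (l%:R / nu%:~R) k.

Variable K : fieldType.

(* $\eta_i$ for i <= 1 (see [etaE], [eta_eq0]); for i > 1 the value is a dummy. *)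
Definition eta (i : int) (f : ratfun K) : ratfun K :=
  if (i <= 1) && (nu %| 1 - i)%Z then
    let k := `|((1 - i) %/ nu)%Z|%N in
    ratr (dcoef k / k`!%:R) * iter k (@ratder K) f
  else 0.

Lemma etaE (k : nat) f : 0 < nu ->
  eta (1 - k%:Z * nu) f = ratr (dcoef k / k`!%:R) * iter k (@ratder K) f.
Proof.
move=> nu0; have h : 0 <= k%:Z * nu by rewrite mulr_ge0// ltW.
rewrite /eta gerBl h.
have -> : 1 - (1 - k%:Z * nu) = k%:Z * nu by rewrite subKr.
by rewrite dvdz_mull// mulzK ?gt_eqF.
Qed.

Lemma eta_eq0 (i : int) f : (i != 1 %[mod nu])%Z -> eta i f = 0.
Proof.
by rewrite eq_sym eqz_mod_dvd => /negPf h; rewrite /eta h andbF.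
Qed.

Lemma eta_linear (i : int) (c : K) (f g : ratfun K) :
  eta i (FracField.tofrac c%:P * f + g) =
  FracField.tofrac c%:P * eta i f + eta i g.
Proof.
rewrite /eta; case: ifP => _; last by rewrite mulr0 addr0.
have -> : forall k, iter k (@ratder K) (FracField.tofrac c%:P * f + g)
    = FracField.tofrac c%:P * iter k (@ratder K) f + iter k (@ratder K) g.
  elim=> //= k ->; rewrite ratderD ratderM ratder_poly derivC.
  by rewrite [FracField.tofrac 0]tofrac0 mul0r add0r.
by rewrite mulrDr mulrCA.
Qed.

End Operators.

(* The tuples (l, [:: j_1; ...; j_k]) with k > 0, l, j_1, ..., j_k <= 0 and
   j_1 + ... + j_k - k + l = i. *)
Definition eta_index (i : int) : set (int * seq int) :=
  [set p | [/\ (0 < size p.2)%N, p.1 <= 0, all (fun j => j <= 0) p.2 &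
    \sum_(j <- p.2) j - (size p.2)%:Z + p.1 = i]].

(* A sum over [eta_index i] is thus a genuine finite sum. *)
Lemma finite_eta_index (i : int) : finite_set (eta_index i).
Proof.
pose n := `|i|%N.
pose F (p : 'I_n.+1 * n.-bseq 'I_n.+1) : int * seq int :=
  (- (p.1 : nat)%:Z, [seq - (j : nat)%:Z | j : 'I_n.+1 <- p.2]).
apply: (@sub_finite_set _ _ (range F)); last first.
  by apply: finite_image; exact: finite_finset.
move=> [l js] [/= _ l0 js0 e].
have sle0 (s : seq int) : all (fun j => j <= 0) s -> \sum_(j <- s) j <= 0.
  elim: s => [|x s IH /= /andP[x0 /IH s0]]; first by rewrite big_nil.
  by rewrite big_cons -[0]addr0 lerD.
have S0 := sle0 _ js0.
set S := \sum_(j <- js) j in e S0.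
have sn : (size js <= n)%N by rewrite /n; lia.
have jn j : j \in js -> (`|j| < n.+1)%N.
  move=> jjs; have := js0; rewrite (perm_all _ (perm_to_rem jjs)) /=.
  move=> /andP[j0 /sle0 R0]; move: e.
  rewrite /S (perm_big _ (perm_to_rem jjs)) big_cons /=.
  by move: (\sum_(_ <- _) _) R0 => R R0; rewrite /n; lia.
pose s : seq 'I_n.+1 := [seq inord `|j|%N | j <- js].
have ss : (size s <= n)%N by rewrite size_map.
have ln : (`|l| < n.+1)%N by rewrite /n; lia.
exists (inord `|l|%N, Bseq ss) => //; rewrite /F /=; congr pair.
  by rewrite inordK//; lia.
rewrite -map_comp map_id_in// => j jjs /=; rewrite inordK ?jn//.
by have /allP/(_ _ jjs) := js0; lia.
Qed.

(* Unconditional convergence of $\sum_{i \in I} u_i$ to l in a metric group,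
   i.e. convergence along the net of finite subsets of I. *)
Definition sums_to (I : choiceType) (L : fieldType) (u : I -> laurent L)
  (l : laurent L) : Prop :=
  summability.partial_sum u A @[A --> summability.totally] --> l.

(* Main.v *)
From HB Require Import structures.
Require Import Defs.
From mathcomp Require Import all_boot all_order all_algebra fraction.
From mathcomp Require Import all_classical all_reals all_analysis.
From mathcomp Require Import ring zify Rstruct finmap.
Set Implicit Arguments.
Unset Strict Implicit.
Unset Printing Implicit Defensive.
Import Order.TTheory GRing.Theory Num.Theory.
Local Open Scope classical_set_scope.
Local Open Scope ring_scope.

(* Formally T = X^(1/nu), where X satisfies f X = X f + (nu/r) f'.  Hence
   f T^j = \sum_k (nu/r)^k C(j/nu, k) T^(j - k nu) f^(k), and Lagrange
   interpolation of C(x/nu, k) at x = 0, ..., k identifies the coefficient with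
   lambda_j^k.  Associativity then reduces, on monomials, to the Leibniz rule,
   the Vandermonde convolution and C(n, m) C(x, n) = C(x, m) C(x - m, n - m).
   The twisted product rule for the eta_i compares the coefficients of T^i in
   (a b) T = \sum_l (b T^l) eta_l(a), the powers C^l of the series
   C(z) = (1 + (nu/r) z)^(1/nu) being expanded as \sum_k C(l, k) (C - 1)^k. *)

(** * Binomial coefficients of rational numbers *)

(** Binomial identities over the rationals are proved as polynomial identities: both sides have
    degree at most [d] and agree at [0, ..., d], where [qbin] is the usual binomial coefficient. *)
Definition polyfun (d : nat) (f : rat -> rat) :=
  exists2 p : {poly rat}, (size p <= d.+1)%N & f =1 horner p.

Lemma polyfun_const d c : polyfun d (fun=> c).
Proof.
exists c%:P => [|x]; last by rewrite hornerC.
by rewrite size_polyC; case: eqP.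
Qed.

Lemma polyfunM d e f g :
  polyfun d f -> polyfun e g -> polyfun (d + e) (fun x => f x * g x).
Proof.
move=> [p sp fp] [q sq gq]; exists (p * q) => [|x]; last by rewrite hornerM fp gq.
by rewrite (leq_trans (size_polyMleq _ _))//; lia.
Qed.

Lemma polyfunZ d f c : polyfun d f -> polyfun d (fun x => c * f x).
Proof. by move=> ?; apply: (@polyfunM 0 d) => //; exact: polyfun_const. Qed.

Lemma polyfun_sum d I (r : seq I) (P : pred I) (F : I -> rat -> rat) :
  (forall i, P i -> polyfun d (F i)) ->
  polyfun d (fun x => \sum_(i <- r | P i) F i x).
Proof.
move=> PF; elim: r => [|i r [p sp fp]].
  by exists 0 => [|x]; rewrite ?size_poly0// big_nil horner0.
case Pi: (P i); last by exists p => // x; rewrite big_cons Pi fp.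
have [q sq gq] := PF i Pi.
exists (q + p) => [|x]; last by rewrite big_cons Pi hornerD gq fp.
by rewrite (leq_trans (size_polyD _ _))// geq_max sq.
Qed.

Lemma polyfun_le d e f : (d <= e)%N -> polyfun d f -> polyfun e f.
Proof. by move=> de [p sp fp]; exists p => //; exact: leq_trans sp _. Qed.

Lemma polyfun_qbin_affine k a b : polyfun k (fun x => qbin (a * x + b) k).
Proof.
exists ((k`!%:R)^-1 *: \prod_(i < k) (a *: 'X + (b - i%:R)%:P)) => [|x].
  rewrite (leq_trans (size_scale_leq _ _))//.
  elim: k => [|k IH]; first by rewrite big_ord0 size_poly1.
  rewrite big_ord_recr/= (leq_trans (size_polyMleq _ _))//.
  have : (size (a *: 'X + (b - k%:R)%:P)%R <= 2)%N.
    rewrite (leq_trans (size_polyD _ _))// geq_max.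
    rewrite (leq_trans (size_scale_leq _ _)) ?size_polyX//.
    by rewrite size_polyC; case: eqP.
  by move=> h; have := leq_add IH h; rewrite addn2; case: (_ + _)%N.
rewrite hornerZ horner_prod /qbin mulrC; congr (_ * _).
by apply: eq_bigr => i _; rewrite hornerD hornerZ hornerX hornerC addrA.
Qed.

Lemma eq_polyfun d f g : f =1 g -> polyfun d f -> polyfun d g.
Proof. by move=> /funext ->. Qed.

Lemma polyfun_qbinDr k a : polyfun k (fun x => qbin (x + a) k).
Proof. by apply: eq_polyfun (polyfun_qbin_affine k 1 a) => x; rewrite mul1r. Qed.

Lemma polyfun_qbin k : polyfun k (qbin^~ k).
Proof. by apply: eq_polyfun (polyfun_qbinDr k 0) => x; rewrite addr0. Qed.

Lemma polyfun_eq d f g : polyfun d f -> polyfun d g ->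
  (forall n, (n <= d)%N -> f n%:R = g n%:R) -> f =1 g.
Proof.
move=> [p sp fp] [q sq gq] fg x; rewrite fp gq; apply/eqP.
rewrite -subr_eq0 -hornerN -hornerD.
suff -> : p - q = 0 by rewrite horner0.
apply: (@roots_geq_poly_eq0 _ _ [seq n%:R | n <- iota 0 d.+1]).
- apply/allP => y /mapP[n]; rewrite mem_iota add0n ltnS => nd ->.
  by rewrite rootE hornerD hornerN -fp -gq fg// subrr.
- rewrite map_inj_uniq ?iota_uniq// => m n /eqP.
  by rewrite eqr_nat => /eqP.
rewrite size_map size_iota (leq_trans (size_polyD _ _))// geq_max sp.
by rewrite size_polyN.
Qed.

Lemma qbin_nat n k : qbin n%:R k = 'C(n, k)%:R.
Proof.
have -> : qbin n%:R k = (n ^_ k)%:R / k`!%:R.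
  congr (_ / _); elim: k => [|k IH]; first by rewrite big_ord0 ffactn0.
  rewrite big_ord_recr/= IH ffactnSr natrM.
  have [kn|nk] := leqP k n; first by rewrite natrB.
  by rewrite ffact_small// !mul0r.
rewrite -bin_ffact natrM mulfK// pnatr_eq0 -lt0n fact_gt0 //.
Qed.

Lemma qbin0 x : qbin x 0 = 1.
Proof. by rewrite /qbin big_ord0 divr1. Qed.

Lemma qbin0n k : qbin 0 k = (k == 0%N)%:R.
Proof. by rewrite (qbin_nat 0) bin0n. Qed.

Lemma qbin_vandermonde x y n :
  qbin (x + y) n = \sum_(i < n.+1) qbin x i * qbin y (n - i).
Proof.
move: x; apply: (@polyfun_eq n); first exact: polyfun_qbinDr.
  apply: polyfun_sum => i _; have {1}-> : n = (i + (n - i))%N by have := ltn_ord i; lia.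
  by apply: polyfunM; [exact: polyfun_qbin|exact: polyfun_const].
(* Once x is a natural number, the same principle applies in y. *)
move=> m _; move: y; apply: (@polyfun_eq n).
- by apply: eq_polyfun (polyfun_qbinDr _ m%:R) => z; rewrite addrC.
- apply: polyfun_sum => i _; apply: polyfunZ.
  by apply: polyfun_le (polyfun_qbin _); rewrite leq_subr.
move=> l _; rewrite -natrD qbin_nat -binomial.Vandermonde natr_sum.
by apply: eq_bigr => i _; rewrite natrM !qbin_nat.
Qed.

(** Cut the falling factorial of [x] of length [n] after [m] factors: the remaining ones form the
    falling factorial of [x - m]. *)
Lemma qbinM_trinomial x m n : (m <= n)%N ->
  'C(n, m)%:R * qbin x n = qbin x m * qbin (x - m%:R) (n - m).
Proof.
move=> mn; rewrite /qbin -(subnKC mn); set p := (n - m)%N.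
rewrite addKn big_split_ord/=.
under [X in _ * X / _]eq_bigr do rewrite natrD opprD addrA.
have f0 k : k`!%:R != 0 :> rat by rewrite pnatr_eq0 -lt0n fact_gt0.
rewrite -(bin_fact (leq_addr p m)) addKn !natrM.
have C0 : 'C(m + p, m)%:R != 0 :> rat by rewrite pnatr_eq0 -lt0n bin_gt0 leq_addr.
by field; rewrite !f0 C0.
Qed.

(* Lagrange interpolation of x |-> qbin (x / nu) k at the nodes 0, ..., k. *)
Lemma qbin_interpolation (nu j : rat) k : (0 < k)%N ->
  \sum_(1 <= l < k.+1)
    (-1) ^+ (k - l) * qbin j l * qbin (j - l%:R - 1) (k - l) * qbin (l%:R / nu) k
  = qbin (j / nu) k.
Proof.
move=> k0; rewrite big_add1 big_mkord /=.
(* The index [l] stands for the node [l.+1]; the node 0 needs no summand because [qbin 0 k = 0] for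
   [k > 0]. *)
pose F (l : 'I_k) x := qbin (l.+1%:R / nu) k *
  ((-1) ^+ (k - l.+1) * (qbin x l.+1 * qbin (x - l.+1%:R - 1) (k - l.+1))).
suff H : (fun x => \sum_(l < k) F l x) =1 (fun x => qbin (x / nu) k).
  by rewrite -H; apply: eq_bigr => l _; rewrite /F; ring.
apply: (@polyfun_eq k).
- apply: polyfun_sum => l _; do 2!apply: polyfunZ.
  have {1}-> : k = (l.+1 + (k - l.+1))%N by have := ltn_ord l; lia.
  apply: polyfunM; first exact: polyfun_qbin.
  apply: eq_polyfun (polyfun_qbinDr _ (- l.+1%:R - 1)) => x.
  by rewrite addrA.
- apply: eq_polyfun (polyfun_qbin_affine k nu^-1 0) => x.
  by rewrite addr0 mulrC.
case=> [|n] nk.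
  rewrite mul0r qbin0n gtn_eqF// big1// => l _.
  by rewrite /F (qbin_nat 0) mul0r !mulr0.
have nk' : (n < k)%N by [].
(* At the node [n.+1] only its own summand survives, and [qbin (-1) (k - n.+1)] cancels its sign. *)
rewrite (bigD1 (Ordinal nk'))//= big1 ?addr0 => [|l /eqP ln].
  rewrite /F/= qbin_nat binn mul1r subrr sub0r.
  suff -> : qbin (-1) (k - n.+1) = (-1) ^+ (k - n.+1).
    by rewrite -exprMn mulrNN mulr1 expr1n mulr1.
  move: (k - n.+1)%N => m; rewrite /qbin.
  have -> : \prod_(i < m) (-1 - i%:R) = (-1) ^+ m * m`!%:R :> rat.
    elim: m => [|m IH]; first by rewrite big_ord0 mul1r.
    by rewrite big_ord_recr/= IH factS natrM exprS -[in m.+1%:R]add1n natrD; ring.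
  by rewrite mulfK// pnatr_eq0 -lt0n fact_gt0.
have {}ln : l <> n :> nat by move=> e; apply: ln; apply: val_inj.
(* For [l > n] the binomial of [n.+1] over [l.+1] is zero; for [l < n] the other one is, as
   [n - l.+1] is a natural number below [k - l.+1]. *)
rewrite /F; have [nl|ln'] := ltnP n l.
  by rewrite qbin_nat bin_small// mul0r !mulr0.
have -> : n.+1%:R - l.+1%:R - 1 = (n - l.+1)%:R :> rat.
  by rewrite natrB; [rewrite -[in n.+1%:R]addn1 natrD; ring|lia].
by rewrite [X in _ * (_ * (_ * X))]qbin_nat bin_small ?mulr0 //; have := ltn_ord l; lia.
Qed.

(** * The coefficients lambda_j^k *)

(** Interpolation removes the alternating sum; the convolution and trinomial identities below rest
    on this closed form. *)
Lemma lamE (r nu j : int) k :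
  lam r nu j k = (nu%:~R / r%:~R) ^+ k * qbin (j%:~R / nu%:~R) k.
Proof.
rewrite /lam; case: k => [|k] /=; first by rewrite expr0 qbin0 mul1r.
by rewrite -qbin_interpolation.
Qed.

Lemma lam0 r nu j : lam r nu j 0 = 1.
Proof. by []. Qed.

Lemma lam0k r nu k : lam r nu 0 k = (k == 0%N)%:R.
Proof. by rewrite lamE mul0r qbin0n; case: k => [|k]; rewrite ?mulr1 ?mulr0. Qed.

Lemma lam1k r nu k : lam r nu 1 k = dcoef r nu k / k`!%:R.
Proof. by rewrite lamE div1r /dcoef /qbin mulrA. Qed.

(** Vandermonde at [i / nu] and [j / nu]. It expresses that moving f past T^i and then T^j agrees
    with moving it past T^(i + j). *)
Lemma lam_convolution (r nu i j : int) (k : nat) :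
  \sum_(p < k.+1) lam r nu i p * lam r nu j (k - p) = lam r nu (i + j) k.
Proof.
rewrite lamE intrD mulrDl qbin_vandermonde mulr_sumr; apply: eq_bigr => p _.
have -> : (nu%:~R / r%:~R : rat) ^+ k = (nu%:~R / r%:~R) ^+ p * (nu%:~R / r%:~R) ^+ (k - p).
  by rewrite -exprD subnKC ?leq_ord.
by rewrite !lamE; ring.
Qed.

(** Subtracting [m * nu] from [j] lowers [j / nu] by exactly [m], the shift in the trinomial
    identity. *)
Lemma lam_trinomial (r nu j : int) (m p : nat) : nu != 0 ->
  'C(m + p, m)%:R * lam r nu j (m + p) =
  lam r nu j m * lam r nu (j - m%:Z * nu) p.
Proof.
move=> nu0; have nuQ : nu%:~R != 0 :> rat by rewrite intr_eq0.
rewrite !lamE intrB intrM mulrBl mulfK// exprD.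
have := qbinM_trinomial (j%:~R / nu%:~R) (leq_addr p m); rewrite addKn => h.
rewrite mulrCA h; ring.
Qed.

(** * Compositions of integers and powers of binomial series *)

Fixpoint compositions (k p : nat) : seq (seq nat) :=
  if k is k'.+1 then [seq j :: t | j <- iota 1 p, t <- compositions k' (p - j)]
  else if p == 0%N then [:: [::]] else [::].

Lemma mem_compositions k p s :
  (s \in compositions k p) = [&& size s == k, all (leq 1) s & sumn s == p].
Proof.
elim: k p s => [|k IH] p s /=.
  by case: p s => [|p] [|x s].
apply/allpairsPdep/idP => [[j [t []]]|].
  rewrite mem_iota IH => jp /and3P[/eqP st t0 /eqP sp] ->/=.
  by rewrite st eqxx t0 sp/=; lia.
case: s => [|j t]//= /and3P[st /andP[j1 t0] /eqP sp].
exists j, t; rewrite mem_iota IH t0; split=> //; first by lia.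
by move: st; rewrite eqSS => ->; rewrite -sp addKn eqxx.
Qed.

Lemma compositions_uniq k p : uniq (compositions k p).
Proof.
elim: k p => [|k IH] p /=; first by case: ifP.
apply: allpairs_uniq_dep; rewrite ?iota_uniq// => -[j t] [j' t'] _ _ /= [-> ->//].
Qed.

Section CompositionWeights.
Variables (u y : rat).
(** These are the coefficients of C(z) = (1 + u z)^y. As C has constant term 1, [W k p] is the
    coefficient of z^p in (C - 1)^k. *)
Let c (m : nat) := u ^+ m * qbin y m.
Let W k p := \sum_(s <- compositions k p) \prod_(m <- s) c m.

Let W0 p : W 0 p = (p == 0%N)%:R.
Proof. by rewrite /W /=; case: eqP; rewrite ?big_seq1 ?big_nil. Qed.

Let WS k p : W k.+1 p = \sum_(j < p) c j.+1 * W k (p - j.+1).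
Proof.
rewrite /W /= big_allpairs_dep.
have -> : iota 1 p = index_iota 1 p.+1 by rewrite /index_iota subn1.
rewrite big_add1 big_mkord.
by apply: eq_bigr => j _; rewrite mulr_sumr; apply: eq_bigr => s _; rewrite big_cons.
Qed.

(** The coefficient of z^p in C^n = (1 + (C - 1))^n, by induction on [n]. *)
Let W_nat n p :
  \sum_(k < n.+1) 'C(n, k)%:R * W k p = u ^+ p * qbin (n%:R * y) p.
Proof.
elim: n p => [|n IH] p.
  by rewrite big_ord1 bin0 mul1r W0 mul0r qbin0n; case: p => [|p]; rewrite ?mulr1 ?mulr0.
rewrite big_ord_recl/= bin0 mul1r.
(* Pascal's rule splits C^(n+1) into C^n and C^n (C - 1). *)
under eq_bigr do rewrite /bump/= add1n binS natrD mulrDl.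
rewrite big_split/= addrA.
have -> : W 0 p + \sum_(k < n.+1) 'C(n, k.+1)%:R * W k.+1 p
    = \sum_(k < n.+1) 'C(n, k)%:R * W k p.
  rewrite [RHS]big_ord_recl big_ord_recr/= bin0 mul1r bin_small// mul0r addr0.
  by [].
rewrite IH; under eq_bigr do rewrite WS mulr_sumr.
rewrite exchange_big/=.
under eq_bigr => j _.
  under eq_bigr do rewrite mulrCA.
  rewrite -mulr_sumr IH.
  over.
rewrite -[n.+1]add1n natrD mulrDl mul1r qbin_vandermonde big_ord_recl/=.
rewrite qbin0 mul1r subn0 mulrDr; congr (_ + _).
rewrite mulr_sumr; apply: eq_bigr => j _; rewrite /bump/= add1n /c.
have -> : u ^+ p = u ^+ j.+1 * u ^+ (p - j.+1) by rewrite -exprD subnKC.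
ring.
Qed.

(** For fixed [p] both sides are polynomials in [x] of degree at most [p], so natural exponents
    suffice. *)
Lemma sum_compositions x p :
  \sum_(k < p.+1) qbin x k * W k p = u ^+ p * qbin (x * y) p.
Proof.
move: x; apply: (@polyfun_eq p).
- apply: polyfun_sum => k _; apply: eq_polyfun (polyfunZ (W k p) (polyfun_le _ (polyfun_qbin k))).
    by move=> x; rewrite mulrC.
  by rewrite -ltnS.
- apply: polyfunZ; apply: eq_polyfun (polyfun_qbin_affine p y 0) => x.
  by rewrite addr0 mulrC.
move=> n np; rewrite -W_nat.
under eq_bigr do rewrite qbin_nat.
rewrite -!(big_mkord xpredT (fun k => 'C(n, k)%:R * W k p)).
rewrite (@big_cat_nat _ _ _ n.+1)//= -[RHS]addr0; congr (_ + _).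
rewrite big_nat_cond big1 // => k; rewrite andbT => /andP[nk _].
by rewrite bin_small// mul0r.
Qed.

End CompositionWeights.

(** * Derivations of K(beta) *)

(** In characteristic 0 the denominators stay invertible in [F]. The morphism is given by an
    existential since it depends on this hypothesis. *)
Lemma ratr_rmorphism (F : fieldType) : [pchar F] =i pred0 ->
  exists phi : {rmorphism rat -> F}, phi =1 @ratr F.
Proof.
move=> charF.
have injZtoQ : injective (intr : int -> rat) by exact: intr_inj.
have z0 (z : int) : z != 0 -> z%:~R != 0 :> F.
  move=> z0; have : (`|z|%N)%:R != 0 :> F.
    by rewrite (pcharf0P _).1//; lia.
  case: z z0 => n _ //=; by rewrite NegzE mulrNz oppr_eq0.
have q0 (x : rat) : (denq x)%:~R != 0 :> F by rewrite z0 ?denq_neq0.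
(* [ratr] reads off the reduced fraction; cross-multiplication shows that any other fraction gives
   the same value. *)
have fracE (n d : int) : d != 0 -> ratr (n%:~R / d%:~R) = n%:~R / d%:~R :> F.
  move=> d0; set x := _ / _ : rat; apply/eqP; rewrite /ratr eqr_div ?z0 ?denq_neq0//.
  rewrite -!intrM; apply/eqP; congr _%:~R; apply: injZtoQ.
  by rewrite !intrM numqE {1}/x mulrAC divfK ?intr_eq0.
have numden (x : rat) : x = (numq x)%:~R / (denq x)%:~R by rewrite divq_num_den.
have rB : zmod_morphism (@ratr F).
  move=> x y; rewrite [in LHS](numden x) [in LHS](numden y).
  rewrite -mulNr addf_div ?intr_eq0 ?denq_neq0// -!rmorphN -!intrM -intrD.
  rewrite fracE ?mulf_neq0 ?denq_neq0// /ratr -mulNr addf_div//.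
  by rewrite !(intrD, intrM, mulrNz).
have rM : monoid_morphism (@ratr F).
  split=> [|x y]; first by rewrite (ratr_nat _ 1).
  rewrite [in LHS](numden x) [in LHS](numden y) mulf_div -!intrM.
  by rewrite fracE ?mulf_neq0 ?denq_neq0// /ratr mulf_div !intrM.
pose phiA := GRing.isZmodMorphism.Build _ _ (@ratr F) rB.
pose phiM := GRing.isMonoidMorphism.Build _ _ (@ratr F) rM.
pose phi : {rmorphism rat -> F} := HB.pack (@ratr F) phiA phiM.
by exists phi.
Qed.

Section RatderAdditive.
Variable K : fieldType.
Fact ratder_zmod_morphism : zmod_morphism (@ratder K).
Proof.
have d0 : ratder 0 = 0 :> ratfun K.
  by apply: (addrI (ratder 0)); rewrite -ratderD !addr0.
by move=> x y; apply/eqP; rewrite eq_sym subr_eq -ratderD subrK.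
Qed.
HB.instance Definition _ :=
  GRing.isZmodMorphism.Build (ratfun K) (ratfun K) (@ratder K) ratder_zmod_morphism.
Fact iter_ratder_zmod_morphism n : zmod_morphism (iter n (@ratder K)).
Proof.
elim: n => [//|n IH x y].
have -> : iter n.+1 (ratder (K:=K)) (x - y) = ratder (iter n (@ratder K) (x - y)) by [].
rewrite (IH x y); exact: raddfB.
Qed.
HB.instance Definition _ n :=
  GRing.isZmodMorphism.Build (ratfun K) (ratfun K) (iter n (@ratder K))
    (iter_ratder_zmod_morphism n).
End RatderAdditive.

Section RatfunScalars.
Variables (K : fieldType) (charK : [pchar K] =i pred0).
Local Notation L := (ratfun K).
Local Notation D := (@ratder K).
Local Notation q2L := (@ratr L).

Lemma pchar_ratfun : [pchar L] =i pred0.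
Proof.
move=> p; rewrite -charK.
exact: (fmorph_pchar (@FracField.tofrac {poly K} \o polyC : {rmorphism K -> L})).
Qed.

(** Rational scalars are constant polynomials, so the derivation kills them. *)
Lemma ratr_ratfun (x : rat) : q2L x = FracField.tofrac (ratr x : K)%:P.
Proof.
pose f : {rmorphism K -> L} := @FracField.tofrac {poly K} \o polyC.
by rewrite -[RHS]/(f (ratr x)) /ratr fmorph_div !rmorph_int.
Qed.

Lemma ratrM : {morph q2L : x y / x * y}.
Proof. by have [f fE] := ratr_rmorphism pchar_ratfun; move=> x y; rewrite -!fE rmorphM. Qed.

Lemma ratr_sum I (s : seq I) (P : pred I) (F : I -> rat) :
  q2L (\sum_(i <- s | P i) F i) = \sum_(i <- s | P i) q2L (F i).
Proof.
have [f fE] := ratr_rmorphism pchar_ratfun.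
by rewrite -fE rmorph_sum; apply: eq_bigr => i _; rewrite fE.
Qed.

Lemma iter_ratder_ratr n (c : rat) x : iter n D (q2L c * x) = q2L c * iter n D x.
Proof.
elim: n => //= n ->; rewrite ratderM ratr_ratfun ratder_poly derivC.
by rewrite [FracField.tofrac 0]tofrac0 mul0r add0r.
Qed.

Lemma iter_ratder1 n : iter n.+1 D 1 = 0.
Proof.
rewrite iterSr -[1]tofrac1 ratder_poly -polyC1 derivC tofrac0.
exact: raddf0.
Qed.

Lemma leibniz n a b :
  iter n D (a * b) = \sum_(m < n.+1) 'C(n, m)%:R * iter m D a * iter (n - m) D b.
Proof.
elim: n => [|n IH]; first by rewrite big_ord1 bin0 mul1r.
rewrite iterS IH raddf_sum.
have E (m : 'I_n.+1) : D ('C(n, m)%:R * iter m D a * iter (n - m) D b) =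
   'C(n, m)%:R * iter m D a * iter (n.+1 - m) D b +
   'C(n, m)%:R * iter m.+1 D a * iter (n - m) D b.
  rewrite -[_%:R](ratr_nat L) -mulrA.
  rewrite [LHS](iter_ratder_ratr 1)/= ratderM subSn ?leq_ord// iterS; ring.
rewrite (eq_bigr _ (fun m _ => E m)).
rewrite big_split/= [RHS]big_ord_recl/= !bin0 mul1r.
under [in RHS]eq_bigr do rewrite /bump/= add1n subSS binS natrD !mulrDl.
rewrite big_split/= addrA big_ord_recl/= bin0 mul1r; congr (_ + _ + _).
by rewrite [RHS]big_ord_recr/= bin_small// !mul0r addr0.
Qed.

End RatfunScalars.

(** * The product rule for eta *)

(** Parts are at least 1, so there are at most [p] of them and the blocks [k = 0, ..., p] are
    exhaustive. *)
Definition all_compositions (p : nat) : seq (seq nat) :=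
  [seq t | k <- iota 0 p.+1, t <- compositions k p].

Lemma mem_all_compositions p t :
  (t \in all_compositions p) = all (leq 1) t && (sumn t == p).
Proof.
apply/allpairsPdep/idP => [[k [s []]]|/andP[t0 /eqP tp]].
  by rewrite mem_compositions => _ /and3P[_ s1 sp] ->; rewrite s1.
exists (size t), t; rewrite mem_iota mem_compositions eqxx t0 tp eqxx; split=> //.
rewrite /= add0n ltnS -tp; elim: t t0 {tp} => //= x t IH /andP[x1 /IH]; lia.
Qed.

Lemma all_compositions_uniq p : uniq (all_compositions p).
Proof.
(* The length of a list recovers its block, so tagging with it separates the blocks. *)
apply: (@map_uniq _ _ (fun t => (size t, t))); rewrite map_allpairs.
have -> : [seq (size t, t) | k <- iota 0 p.+1, t <- compositions k p]
        = [seq (k, t) | k <- iota 0 p.+1, t <- compositions k p].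
  apply/eq_in_allpairs_dep => k _ t.
  by rewrite mem_compositions => /andP[/eqP ->].
apply: allpairs_uniq_dep => [|k _|[k t] [l s] _ _ /= [-> ->//]].
  exact: iota_uniq.
exact: compositions_uniq.
Qed.

(** The expansion of C^x in powers of C - 1, summed over the tuples themselves, as in the product
    rule. *)
Lemma sum_all_compositions (u y x : rat) p :
  \sum_(t <- all_compositions p) qbin x (size t) * \prod_(m <- t) (u ^+ m * qbin y m)
  = u ^+ p * qbin (x * y) p.
Proof.
rewrite -sum_compositions /all_compositions big_allpairs_dep.
rewrite -[iota 0 _]/(index_iota 0 p.+1) big_mkord; apply: eq_bigr => k _.
rewrite mulr_sumr; apply: eq_big_seq => t; rewrite mem_compositions.
by case/andP => /eqP ->.
Qed.

Section EtaProduct.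
Variables (K : fieldType) (charK : [pchar K] =i pred0) (r nu : int) (nu_gt0 : 0 < nu).
Local Notation L := (ratfun K).
Local Notation D := (@ratder K).
Local Notation q2L := (@ratr L).
Local Notation eta := (eta r nu (K := K)).
(** The exponents at which eta is not zero by definition; those with [m > 0] are the ones in the
    range i <= 0. *)
Local Notation ex := (fun m : nat => 1 - m%:Z * nu).

Lemma eta_lam (k : nat) (f : L) :
  eta (ex k) f = q2L (lam r nu 1 k) * iter k D f.
Proof. by rewrite etaE// lam1k. Qed.

Lemma foldr_eta (s : seq nat) (b : L) :
  foldr eta b (map ex s) =
  q2L (\prod_(m <- s) lam r nu 1 m) * iter (sumn s) D b.
Proof.
elim: s => [|m s IH] /=; first by rewrite big_nil (ratr_nat _ 1) mul1r.
rewrite IH eta_lam iter_ratder_ratr mulrA -ratrM// big_cons.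
by rewrite iterD.
Qed.

Lemma foldr_eta0 (s : seq int) (b : L) :
  ~~ all (fun j => nu %| 1 - j)%Z s -> foldr eta b s = 0.
Proof.
elim: s => //= j s IH; rewrite negb_and => /orP[nj|/IH ->].
  by rewrite eta_eq0// eq_sym eqz_mod_dvd.
rewrite /Defs.eta; case: ifP => // _.
by rewrite raddf0 mulr0.
Qed.

(** The term -k of the index condition absorbs the 1 in each exponent, leaving -nu times the total
    order of derivation. *)
Lemma sum_exponents (s : seq nat) :
  \sum_(j <- map ex s) j - (size (map ex s))%:Z = - ((sumn s)%:Z * nu).
Proof.
elim: s => [|m s IH]; first by rewrite big_nil subrr mul0r oppr0.
rewrite /= big_cons -[(size _).+1]addn1 !PoszD mulrDl.
rewrite (canRL (subrK _) IH); ring.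
Qed.

Lemma ex_index (j : int) : (nu %| 1 - j)%Z -> j <= 0 ->
  exists2 m : nat, (0 < m)%N & j = ex m.
Proof.
move=> /dvdzP[q jq] j0; exists `|q|%N; first by nia.
by rewrite gez0_abs; [rewrite -jq subKr|nia].
Qed.

Lemma ex_indices (s : seq int) : all (fun j => nu %| 1 - j)%Z s -> all (fun j => j <= 0) s ->
  exists2 t : seq nat, all (leq 1) t & s = map ex t.
Proof.
elim: s => [|j s IH] /=; first by exists [::].
move=> /andP[jn sn] /andP[j0 s0]; have [t t1 ->] := IH sn s0.
by have [m m0 ->] := ex_index jn j0; exists (m :: t) => //=; rewrite m0.
Qed.

Lemma ex_inj : injective ex.
Proof. move=> m n; nia. Qed.

(** A nonzero summand has all its indices of the form [ex], and the index condition then says that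
    the orders of derivation add up. *)
Lemma eta_index_support (i : int) (a b : L) (p : int * seq int) :
  eta_index i p ->
  q2L (qbin p.1%:~R (size p.2)) * eta p.1 a * foldr eta b p.2 <> 0 ->
  exists m t, [/\ p = (ex m, map ex t), (0 < m)%N, all (leq 1) t,
    (0 < size t)%N & i = ex (m + sumn t)].
Proof.
case: p => l s /= [s0 l0 sle <-] nz.
have ln : (nu %| 1 - l)%Z.
  apply/negPn/negP => ln; apply: nz.
  by rewrite eta_eq0 ?mulr0 ?mul0r// eq_sym eqz_mod_dvd.
have sn : all (fun j => nu %| 1 - j)%Z s.
  by apply/negPn/negP => sn; apply: nz; rewrite foldr_eta0 ?mulr0.
have [m m0 ->] := ex_index ln l0; have [t t1 st] := ex_indices sn sle.
exists m, t; rewrite st; split=> //; first by rewrite -(size_map ex) -st.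
by rewrite sum_exponents PoszD /=; ring.
Qed.

(** The sum over compositions turns the products of lambda_1 into lambda_(1 - m nu)^(n - m); the
    trinomial identity then gives the m-th inner term of the Leibniz rule, scaled by lambda_1^n. *)
Lemma eta_product_coef (n m : nat) (a b : L) : (0 < m < n)%N ->
  \sum_(t <- all_compositions (n - m))
    q2L (qbin (ex m)%:~R (size t)) * eta (ex m) a * foldr eta b (map ex t)
  = q2L (lam r nu 1 n) * ('C(n, m)%:R * iter m D a * iter (n - m) D b).
Proof.
move=> /andP[m0 mn].
have nuQ : nu%:~R != 0 :> rat by rewrite intr_eq0 gt_eqF.
pose c t := qbin (ex m)%:~R (size t) * \prod_(j <- t) lam r nu 1 j.
rewrite (eq_big_seq (fun t => q2L (c t) *
    (q2L (lam r nu 1 m) * iter m D a * iter (n - m) D b))) => [|t]; last first.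
  rewrite mem_all_compositions => /andP[_ /eqP tn].
  by rewrite eta_lam foldr_eta tn /c ratrM//; ring.
rewrite -mulr_suml -ratr_sum//.
under eq_bigr => t _.
  rewrite /c; under eq_bigr do rewrite lamE.
  over.
rewrite sum_all_compositions.
have reassoc (x y z c' v w : L) : x * y = z * c' -> x * (y * v * w) = z * (c' * v * w).
  by move=> xyz; rewrite -!mulrA !(mulrA x) xyz -!mulrA.
apply: reassoc; rewrite -(ratr_nat L) -ratrM// -ratrM//; congr ratr.
have nE : (m + (n - m))%N = n by rewrite subnKC// ltnW.
have := lam_trinomial r 1 m (n - m) (lt0r_neq0 nu_gt0).
rewrite nE mulrC => ->; rewrite [lam _ _ (ex m) _]lamE div1r mulrC.
by [].
Qed.

(** For i = 1 - n nu this is the Leibniz rule for the n-th derivative: its terms m = 0 and m = n are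
    the first two summands, the inner ones form the sum over tuples. *)
Lemma eta_product (i : int) (a b : L) : i <= 0 ->
  eta i (a * b) = a * eta i b + eta i a * b +
    \sum_(p \in eta_index i)
      q2L (qbin p.1%:~R (size p.2)) * eta p.1 a * foldr eta b p.2.
Proof.
move=> i0.
(* If [nu] does not divide [1 - i], every term on both sides is zero. *)
have [idvd|ndvd] := boolP (nu %| 1 - i)%Z; last first.
  have ei f : eta i f = 0 by apply: eta_eq0; rewrite eq_sym eqz_mod_dvd.
  rewrite !ei mulr0 mul0r !add0r fsbig1// => p pi; apply: contrapT => nz.
  have [m [t [_ _ _ _ e]]] := eta_index_support pi nz.
  by move: ndvd; rewrite e subKr dvdz_mull.
have [n n0 ein] := ex_index idvd i0.
(* This list contains the support: the order [m] falling on [a] and the order [n - m] falling on [b]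
   are both positive. *)
pose R := [seq (ex m, map ex t) | m <- iota 1 n.-1, t <- all_compositions (n - m)].
have uR : uniq R.
  apply: allpairs_uniq_dep => [|m _|[m t] [m' t'] _ _ /= []]; first exact: iota_uniq.
    exact: all_compositions_uniq.
  by move=> /ex_inj -> /(inj_map ex_inj) ->.
have nzR p : (eta_index i `\` [set` R]) p ->
    q2L (qbin p.1%:~R (size p.2)) * eta p.1 a * foldr eta b p.2 = 0.
  move=> [pi pR]; apply: contrapT => nz.
  have [m [t [pE m0 t1 t0 e]]] := eta_index_support pi nz.
  apply: pR; rewrite pE /=; apply/allpairsPdep; exists m, t; split=> //.
    rewrite mem_iota m0; move: e; rewrite ein => /ex_inj ->.
    by case: t t1 t0 {nz pi pE} => //= x t /andP[]; lia.
  rewrite mem_all_compositions t1 /=; move: e; rewrite ein => /ex_inj ->.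
  by rewrite addKn.
have RA : [set` R] `<=` eta_index i.
  move=> p /= /allpairsPdep[m [t [mn tp ->]]].
  move: mn tp; rewrite mem_iota mem_all_compositions => mn /andP[t1 /eqP tn]; split=> /=.
  + by case: t tn {t1} => //=; lia.
  + nia.
  + by apply/allP => _ /mapP[x /(allP t1) x1 ->]; nia.
  by rewrite sum_exponents tn ein -subzn; nia.
rewrite -(fsbig_widen _ _ _ RA nzR) -fsbig_seq// big_allpairs_dep.
rewrite (eq_big_seq (fun m => q2L (lam r nu 1 n) *
    ('C(n, m)%:R * iter m D a * iter (n - m) D b))) => [|m]; last first.
  rewrite mem_iota => mn; rewrite -eta_product_coef; last by lia.
  by apply: eq_bigr => t _ /=; rewrite size_map.
rewrite -mulr_sumr ein !eta_lam leibniz//.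
case: n n0 {ein R uR nzR RA} => // n _ /=.
have -> : iota 1 n = index_iota 1 n.+1 by rewrite /index_iota subn1.
rewrite big_add1 big_mkord big_ord_recl big_ord_recr/= binn subnn bin0 !mul1r.
have reassoc (q x y z w S : L) : x * (q * y) + q * z * w + q * S = q * (x * y + (S + z * w)).
  by ring.
by rewrite reassoc.
Qed.

End EtaProduct.

(** * Laurent series and their topology *)

Section LaurentTheory.
Variable L : fieldType.
Implicit Types (f g : laurent L) (i j m n : int).

(** This is deg f <= m, covering the zero series without a case distinction. *)
Definition vanish_above f m := forall i, m < i -> f i = 0.

Lemma vanish_above_le f m n : m <= n -> vanish_above f m -> vanish_above f n.
Proof. by move=> mn fm i ni; apply: fm; exact: le_lt_trans ni. Qed.

Lemma vanish_aboveD f g m :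
  vanish_above f m -> vanish_above g m -> vanish_above (f + g) m.
Proof. by move=> fm gm i mi; rewrite Defs.coefD fm// gm// addr0. Qed.

Lemma vanish_above_sum I (s : seq I) (P : pred I) (F : I -> laurent L) m :
  (forall x, P x -> vanish_above (F x) m) -> vanish_above (\sum_(x <- s | P x) F x) m.
Proof.
move=> FP; elim/big_rec: _ => [i _|x f Px fm]; first by rewrite Defs.coef0.
by apply: vanish_aboveD => //; exact: FP.
Qed.

Lemma lmono_vanish i (a : L) : vanish_above (lmono i a) i.
Proof. by move=> j ij; rewrite /= gt_eqF. Qed.

Lemma lmono0 i : lmono i (0 : L) = 0.
Proof. by apply: laurentP => j /=; case: eqP. Qed.

Lemma laurent_coef_sum I (s : seq I) (P : pred I) (F : I -> laurent L) i :
  (\sum_(x <- s | P x) F x) i = \sum_(x <- s | P x) F x i.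
Proof. exact: (big_morph (fun f : laurent L => f i) (fun f g => erefl) erefl). Qed.

Lemma rscale_lmono i (a b : L) : rscale (lmono i a) b = lmono i (a * b).
Proof. by apply: laurentP => j /=; case: eqP; rewrite ?mul0r. Qed.

Lemma vanish_sub_leading f m :
  vanish_above f m -> vanish_above (f - lmono m (f m)) (m - 1).
Proof.
move=> fm i mi; rewrite Defs.coefD Defs.coefN /=; case: eqVneq => [->|im]; first exact: subrr.
by rewrite subr0 fm//; lia.
Qed.

Lemma laurent_truncate f m (Q : nat) : vanish_above f m ->
  vanish_above (f - \sum_(q < Q) lmono (m - q%:Z) (f (m - q%:Z))) (m - Q%:Z).
Proof.
move=> fm; elim: Q => [|Q IH]; first by rewrite big_ord0 !subr0.
rewrite big_ord_recr/= opprD addrA.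
move=> i mi; have [->|im] := eqVneq i (m - Q%:Z).
  rewrite Defs.coefD Defs.coefN /= eqxx laurent_coef_sum big1 ?subr0 ?subrr// => q _ /=.
  by case: eqP => // e; have := ltn_ord q; lia.
by rewrite Defs.coefD IH; [rewrite Defs.coefN /= (negPf im) subr0|lia].
Qed.

(** A series is a finite sum of monomials plus a tail vanishing above [m]. For a statement about one
    coefficient, [m] is taken so low that the tail cannot contribute. *)
Lemma laurent_mono_ind (P : laurent L -> Prop) (m : int) :
  (forall f g, P f -> P g -> P (f + g)) ->
  (forall i a, P (lmono i a)) ->
  (forall f, vanish_above f m -> P f) -> forall f, P f.
Proof.
move=> PD Pmono Pv f; have [M fM] := coefP f.
rewrite -[f](subrK (\sum_(q < `|M - m|%N) lmono (M - q%:Z) (f (M - q%:Z)))).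
apply: (PD).
  apply: (Pv); have := laurent_truncate (Q := `|M - m|%N) fM.
  by apply: vanish_above_le; lia.
apply: (big_ind P) => [|x y|q _]; [by apply: Pv|exact: PD|exact: Pmono].
Qed.

Lemma nbhs_laurentP f (U : set (laurent L)) :
  nbhs f U <-> exists m, forall g, vanish_above (f - g) m -> U g.
Proof.
split=> [/nbhs_ballP[e /= e0 eU]|[m mU]].
  (* By exp(x) >= 1 + x, a degree at most -N with N > [e^-1] gives a distance below [e]. *)
  exists (- (Num.bound e^-1)%:Z) => g /deg_leP fg; apply: eU.
  rewrite ballEmdist/= /mdist/= /ldist /labs; move: fg.
  case: deg => [d||]//=; rewrite lee_fin => dn.
  have en : e^-1 < (Num.bound e^-1)%:R by rewrite archi_boundP// invr_ge0 ltW.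
  have nd : (Num.bound e^-1)%:R <= expR (- d%:~R) :> Rdefinitions.R.
    apply: le_trans (expR_ge1Dx _); rewrite -rmorphN/= -[1]/(1%:~R) -intrD.
    by rewrite -[_%:R]/((Num.bound e^-1)%:Z%:~R) ler_int; lia.
  by rewrite -ltf_pV2 ?posrE ?expR_gt0// -expRN (lt_le_trans en).
apply/nbhs_ballP; exists (expR m%:~R) => /=; first exact: expR_gt0.
move=> g; rewrite ballEmdist/= => fg; apply: mU.
have [->|h0] := eqVneq (f - g) 0; first by move=> i _; exact: Defs.coef0.
have [k /degP kE] := is_deg_ex h0; apply/deg_leP; move: fg.
by rewrite /mdist/= /ldist /labs kE ltr_expR ltr_int lee_fin => /ltW.
Qed.

End LaurentTheory.

(** * The deformed product *)

(** Reindexing by (m - p, p) turns the left side into the sum over m + p < Q; outside this triangle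
    [H] is zero. *)
Lemma sum_triangle (V : nmodType) (Q : nat) (H : nat -> nat -> V) :
  (forall m p, (Q <= m + p)%N -> H m p = 0) ->
  \sum_(m < Q) \sum_(p < m.+1) H (m - p)%N p = \sum_(m < Q) \sum_(p < Q) H m p.
Proof.
move=> H0.
transitivity (\sum_(m < Q) \sum_(p < Q | (p <= m)%N) H (m - p)%N p).
  apply: eq_bigr => m _.
  by rewrite (big_ord_widen_cond Q xpredT (fun p => H (m - p)%N p)).
rewrite (exchange_big_dep xpredT)//= [RHS]exchange_big/=; apply: eq_bigr => p _.
transitivity (\sum_(p <= m < Q) H (m - p)%N p).
  by rewrite big_geq_mkord.
rewrite -{1}(add0n p) big_addn -(big_mkord xpredT (fun m => H m p)).
rewrite [RHS](@big_cat_nat _ _ _ (Q - p))//= ?leq_subr// [X in _ = _ + X]big1_seq ?addr0.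
  by apply: eq_bigr => m _; rewrite addnK.
by move=> m /=; rewrite mem_index_iota => mQ; apply: H0; have := ltn_ord p; lia.
Qed.

Section Product.
Variables (K : fieldType) (charK : [pchar K] =i pred0) (r nu : int) (nu_gt0 : 0 < nu).
Local Notation L := (ratfun K).
Local Notation D := (@ratder K).
Local Notation q2L := (@ratr L).
Local Notation lam := (lam r nu).
Implicit Types (f g h : laurent L) (a b c : L).

(** For x = (j, k): the k-th term of T^i f_i T^j g_j has exponent i + j - k nu, and equating this
    with n gives i = n - j + k nu. *)
Definition dmul_term f g (n : int) (x : int * nat) : L :=
  q2L (lam x.1 x.2) * iter x.2 D (f (n - x.1 + x.2%:Z * nu)) * g x.1.

(** Summing over all pairs with finite support keeps degree bounds out of the definition. *)
Definition dmul_coef f g (n : int) : L :=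
  \sum_(x \in [set: int * nat]) dmul_term f g n x.

(** With j = N - q, a nonzero term needs q >= 0 and q + k nu <= M + N - n; as nu >= 1, [Q] bounds
    both q and k. *)
Lemma dmul_coefE f g (M N n : int) (Q : nat) :
  vanish_above f M -> vanish_above g N -> M + N - n < Q%:Z ->
  dmul_coef f g n = \sum_(q < Q) \sum_(k < Q) dmul_term f g n (N - q%:Z, k : nat).
Proof.
move=> fM gN MNQ.
pose R := [seq (N - q%:Z, k) | q <- iota 0 Q, k <- iota 0 Q].
have uR : uniq R.
  apply: allpairs_uniq; rewrite ?iota_uniq// => -[q k] [q' k'] _ _ /= [qq ->].
  by congr pair; lia.
have R0 : [set: int * nat] `\` [set` R] `<=` dmul_term f g n @^-1` [set 0].
  move=> [j k] [_ /= jkR]; rewrite /dmul_term/=.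
  have [jN|Nj] := leP j N; last by rewrite gN ?mulr0.
  have [fz|nz] := leP (n - j + k%:Z * nu) M; last by rewrite fM// raddf0 mulr0 mul0r.
  exfalso; apply: jkR; apply/allpairsP; exists (`|N - j|%N, k) => /=.
  have knu : k%:Z <= k%:Z * nu by nia.
  by rewrite !mem_iota; split; [lia|lia|congr pair; lia].
rewrite /dmul_coef -(fsbig_widen _ _ _ (@subsetT _ _) R0) -fsbig_seq//.
have iotaE : iota 0 Q = index_iota 0 Q by rewrite /index_iota subn0.
rewrite /R big_allpairs_dep iotaE big_mkord; apply: eq_bigr => q _.
by rewrite big_mkord.
Qed.

Lemma dmul_coef_vanish f g (M N : int) :
  vanish_above f M -> vanish_above g N ->
  forall n, M + N < n -> dmul_coef f g n = 0.
Proof.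
move=> fM gN n MNn; rewrite (@dmul_coefE _ _ _ _ _ 0 fM gN) ?big_ord0//; lia.
Qed.

Definition dmul f g : laurent L.
Proof.
exists (dmul_coef f g); have [[M fM] [N gN]] := (coefP f, coefP g).
by exists (M + N); exact: dmul_coef_vanish.
Defined.

Lemma dmul_vanish f g (M N : int) : vanish_above f M -> vanish_above g N ->
  vanish_above (dmul f g) (M + N).
Proof. by move=> fM gN n; exact: dmul_coef_vanish. Qed.

(** * Additivity of the product in each argument *)

Lemma dmulDl : left_distributive dmul +%R.
Proof.
move=> f g h; apply: laurentP => n; rewrite Defs.coefD /=.
have [[M0 fM0] [N0 gN0] [P hP]] := And3 (coefP f) (coefP g) (coefP h).
(* With a common bound, one square of indices serves all three products. *)
pose M := Num.max M0 N0.
have fM : vanish_above f M by apply: vanish_above_le fM0; rewrite le_max lexx.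
have gM : vanish_above g M by apply: vanish_above_le gN0; rewrite le_max lexx orbT.
have Q0 : M + P - n < (`|(M + P - n)%R|%N.+1)%:Z by lia.
rewrite (dmul_coefE fM hP Q0) (dmul_coefE gM hP Q0) (dmul_coefE (vanish_aboveD fM gM) hP Q0).
rewrite -big_split; apply: eq_bigr => q _; rewrite -big_split; apply: eq_bigr => k _.
by rewrite /dmul_term/= raddfD/= mulrDr mulrDl.
Qed.

Lemma dmulDr : right_distributive dmul +%R.
Proof.
move=> h f g; apply: laurentP => n; rewrite Defs.coefD /=.
have [[M0 fM0] [N0 gN0] [P hP]] := And3 (coefP f) (coefP g) (coefP h).
pose M := Num.max M0 N0.
have fM : vanish_above f M by apply: vanish_above_le fM0; rewrite le_max lexx.
have gM : vanish_above g M by apply: vanish_above_le gN0; rewrite le_max lexx orbT.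
have Q0 : P + M - n < (`|(P + M - n)%R|%N.+1)%:Z by lia.
rewrite (dmul_coefE hP fM Q0) (dmul_coefE hP gM Q0) (dmul_coefE hP (vanish_aboveD fM gM) Q0).
rewrite -big_split; apply: eq_bigr => q _; rewrite -big_split; apply: eq_bigr => k _.
by rewrite /dmul_term/= mulrDr.
Qed.

Lemma dmul0l f : dmul 0 f = 0.
Proof. by apply: (addIr (dmul 0 f)); rewrite -dmulDl !add0r. Qed.

Lemma dmul0r f : dmul f 0 = 0.
Proof. by apply: (addIr (dmul f 0)); rewrite -dmulDr !add0r. Qed.

Lemma dmulNl f g : dmul (- f) g = - dmul f g.
Proof. by apply: (addIr (dmul f g)); rewrite -dmulDl !addNr dmul0l. Qed.

Lemma dmulNr f g : dmul f (- g) = - dmul f g.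
Proof. by apply: (addIr (dmul f g)); rewrite -dmulDr !addNr dmul0r. Qed.

Lemma dmul_suml I (s : seq I) (P : pred I) (F : I -> laurent L) g :
  dmul (\sum_(x <- s | P x) F x) g = \sum_(x <- s | P x) dmul (F x) g.
Proof. exact: (big_morph (dmul^~ g) (fun x y => dmulDl x y g) (dmul0l g)). Qed.

Lemma dmul_sumr I (s : seq I) (P : pred I) (F : I -> laurent L) f :
  dmul f (\sum_(x <- s | P x) F x) = \sum_(x <- s | P x) dmul f (F x).
Proof. exact: (big_morph (dmul f) (dmulDr f) (dmul0r f)). Qed.

(** * Products with monomials and associativity *)

Lemma dmul_lmono f (M j n : int) b (Q : nat) :
  vanish_above f M -> M + j - n < Q%:Z ->
  dmul f (lmono j b) n =
  \sum_(k < Q) q2L (lam j k) * iter k D (f (n - j + k%:Z * nu)) * b.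
Proof.
move=> fM MjQ; rewrite /= (dmul_coefE fM (@lmono_vanish _ j b) MjQ).
case: Q {MjQ} => [|Q]; first by rewrite !big_ord0.
rewrite big_ord_recl [X in _ + X]big1 ?addr0 => [|q _].
  apply: eq_bigr => k _; rewrite /dmul_term.
  by rewrite /= eqxx.
rewrite big1// => k _; rewrite /dmul_term/= (_ : _ == j = false) ?mulr0//.
by rewrite /bump/=; lia.
Qed.

(** The k-th term has exponent i + j - k nu <= i + j - k, so the terms with k >= Q do not rise above
    i + j - Q. *)
Lemma dmul_monos_tail (i j : int) a b (Q : nat) :
  vanish_above (dmul (lmono i a) (lmono j b) -
    \sum_(k < Q) lmono (j - k%:Z * nu + i) (q2L (lam j k) * iter k D a * b))
    (i + j - Q%:Z).
Proof.
move=> n nQ; rewrite Defs.coefD Defs.coefN (@dmul_lmono _ i _ _ _ Q)//; last first.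
- by lia.
- exact: lmono_vanish.
rewrite laurent_coef_sum; apply/eqP; rewrite subr_eq0; apply/eqP; apply: eq_bigr => k _ /=.
rewrite (_ : (n - j + k%:Z * nu == i) = (n == j - k%:Z * nu + i)); last first.
  by apply/eqP/eqP => ?; lia.
by case: eqP => //; rewrite raddf0 mulr0 mul0r.
Qed.

(** The T^n coefficients of both sides become one triple sum, by Leibniz on the left and by
    Vandermonde with the trinomial identity on the right. *)
Lemma dmul_monoA f (j l : int) b c :
  dmul (dmul f (lmono j b)) (lmono l c) = dmul f (dmul (lmono j b) (lmono l c)).
Proof.
apply: laurentP => n; have [M fM] := coefP f.
pose Q := `|(M + j + l - n)%R|%N.+1.
have MQ : M + (j + l) - n < Q%:Z by rewrite /Q; lia.
have le_knu (k : nat) : k%:Z <= k%:Z * nu by nia.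
pose F (t : nat) := f (n - l - j + t%:Z * nu).
have F0 t : (Q <= t)%N -> F t = 0.
  by move=> Qt; apply: fM; have := le_knu t; lia.
(* [m] counts the derivatives on [b], [k] those on [f] caused by T^j, and [p] those on [f] caused by
   T^l. *)
pose G m p k := 'C(m + p, p)%:R * (q2L (lam l (m + p)) * q2L (lam j k)) *
  (iter (p + k) D (F (m + p + k)%N) * iter m D b * c).
have G0 m p k : (Q <= m + p + k)%N -> G m p k = 0.
  by move=> h; rewrite /G F0// raddf0 !mul0r mulr0.
transitivity (\sum_(m < Q) \sum_(k < Q) \sum_(p < m.+1) G (m - p)%N p k).
  rewrite (@dmul_lmono _ (M + j) _ _ _ Q); [|exact: dmul_vanish fM (@lmono_vanish _ _ _)|lia].
  apply: eq_bigr => m _.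
  rewrite (@dmul_lmono _ M _ _ _ Q)//; last by have := le_knu m; lia.
  rewrite raddf_sum mulr_sumr mulr_suml; apply: eq_bigr => k _.
  rewrite /= -[X in iter m _ X]mulrA iter_ratder_ratr leibniz//= !mulr_sumr mulr_suml.
  apply: eq_bigr => p _.
  have pm : (p <= m)%N by rewrite -ltnS.
  have fE : f (n - l + m%:Z * nu - j + k%:Z * nu) = F (m + k)%N.
    by rewrite /F PoszD mulrDl; congr (f _); ring.
  rewrite fE /G subnK//.
  rewrite [iter (p + k) _ _]iterD.
  move: (q2L _) (q2L _) (iter _ _ (iter _ _ _)) (iter _ _ b) => x y z w.
  by ring.
transitivity (\sum_(m < Q) \sum_(k < Q) \sum_(p < k.+1) G m p (k - p)%N); last first.
  (* Only [Q] terms of the inner product matter: the tail times [f] has degree below [n]. *)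
  rewrite -[dmul (lmono j b) _](subrK 
    (\sum_(k < Q) lmono (l - k%:Z * nu + j) (q2L (lam l k) * iter k D b * c))).
  rewrite dmulDr Defs.coefD.
  rewrite [X in _ = X + _](dmul_vanish fM (@dmul_monos_tail _ _ _ _ _)) ?add0r; last by lia.
  rewrite dmul_sumr laurent_coef_sum; apply: eq_bigr => m _.
  rewrite (@dmul_lmono _ M _ _ _ Q)//; last by have := le_knu m; lia.
  apply: eq_bigr => k _; rewrite -lam_convolution ratr_sum// !mulr_suml.
  apply: eq_bigr => p _; have pk : (p <= k)%N by rewrite -ltnS.
  have lamE : q2L (lam l m) * q2L (lam (l - m%:Z * nu) p) =
      'C(m + p, p)%:R * q2L (lam l (m + p)).
    rewrite -(ratr_nat L) -!ratrM// -lam_trinomial ?gt_eqF//.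
    by rewrite -[in 'C(_, p)]bin_sub ?leq_addl// addnK.
  rewrite /G mulrA -lamE ratrM// -addnA subnKC// /F PoszD mulrDl.
  have -> : n - (l - m%:Z * nu + j) + k%:Z * nu = n - l - j + (m%:Z * nu + k%:Z * nu) by ring.
  move: (q2L _) (q2L _) (q2L _) (iter _ _ (f _)) (iter _ _ b) => x y z v w.
  ring.
(* [G] vanishes once m + p + k >= Q, so both triangular sums extend to the full cube. *)
have tri1 k : \sum_(m < Q) \sum_(p < m.+1) G (m - p)%N p k = \sum_(m < Q) \sum_(p < Q) G m p k.
  by apply: (@sum_triangle _ Q (fun m p => G m p k)) => m p Qmp; apply: G0; lia.
have tri2 m : \sum_(k < Q) \sum_(p < k.+1) G m p (k - p)%N = \sum_(k < Q) \sum_(p < Q) G m p k.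
  by apply: (@sum_triangle _ Q (fun k p => G m p k)) => k p Qkp; apply: G0; lia.
transitivity (\sum_(m < Q) \sum_(k < Q) \sum_(p < Q) G m p k); last first.
  by apply: eq_bigr => m _; rewrite tri2.
rewrite exchange_big [RHS]exchange_big/=; apply: eq_bigr => k _.
exact: tri1.
Qed.

Lemma dmulA : associative dmul.
Proof.
move=> f g h; apply: laurentP => n; apply/esym.
have [[M fM] [P hP]] := (coefP f, coefP h); move: g.
(* If [g] vanishes above this threshold, both triple products vanish above n - 1. Once [g] is a
   monomial, [h] is reduced in the same way. *)
apply: (laurent_mono_ind (m := n - M - P - 1)) => [g1 g2 e1 e2|j b|g gv].
- by rewrite !(dmulDl, dmulDr) [LHS]Defs.coefD [RHS]Defs.coefD e1 e2.
- move: h {P hP}; apply: (laurent_mono_ind (m := n - M - j - 1)) => [h1 h2 e1 e2|l c|h hv].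
  + by rewrite !dmulDr [LHS]Defs.coefD [RHS]Defs.coefD e1 e2.
  + by rewrite dmul_monoA.
  have jv := @lmono_vanish _ j b.
  rewrite (dmul_vanish (dmul_vanish fM jv) hv); last by lia.
  by rewrite (dmul_vanish fM (dmul_vanish jv hv)); last by lia.
rewrite (dmul_vanish (dmul_vanish fM gv) hP); last by lia.
by rewrite (dmul_vanish fM (dmul_vanish gv hP)); last by lia.
Qed.

(** * The axioms of a right deformed Laurent series ring *)

Lemma dmul_scale f b : dmul f (lconst b) = rscale f b.
Proof.
apply: laurentP => n; have [M fM] := coefP f.
rewrite (@dmul_lmono _ M _ _ _ (`|(M - n)%R|%N.+1))//; last by lia.
rewrite big_ord_recl big1 ?addr0 => [|k _].
  by rewrite lam0 (ratr_nat _ 1) mul1r mul0r subr0.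
by rewrite lam0k (ratr_nat _ 0) !mul0r.
Qed.

Lemma dmul_Tpow i j : dmul (Tpow i) (Tpow j) = Tpow (i + j).
Proof.
apply: laurentP => n.
rewrite (@dmul_lmono _ i _ _ _ (`|(i + j - n)%R|%N.+1)); [|exact: lmono_vanish|lia].
rewrite big_ord_recl big1 ?addr0 => [|k _].
  by rewrite lam0 (ratr_nat _ 1) mul1r mulr1 mul0r addr0 /= subr_eq.
rewrite mulr1 [X in iter _ _ X]/=; case: ifP => _; last by rewrite raddf0 mulr0.
by rewrite iter_ratder1 mulr0.
Qed.

Lemma dmul1l : left_id (Tpow 0) dmul.
Proof.
move=> f; apply: laurentP => n; move: f.
apply: (laurent_mono_ind (m := n - 1)) => [f g e1 e2|j b|f fv].
- by rewrite dmulDr [LHS]Defs.coefD e1 e2.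
(* As T^j b is T^j times the constant b, associativity reduces this to T^0 T^j = T^j. *)
- by rewrite -[b]mul1r -rscale_lmono -dmul_scale dmulA dmul_Tpow add0r.
by rewrite (dmul_vanish (@lmono_vanish _ 0 1) fv) ?fv//; lia.
Qed.

Lemma dmul1r : right_id (Tpow 0) dmul.
Proof. by move=> f; rewrite dmul_scale; apply: laurentP => n /=; rewrite mulr1. Qed.

(** Terms with k > 0 lose k nu > 0 in degree, so the top coefficients simply multiply; in the field
    L this makes the degree additive. *)
Lemma dmul_leading f g (M N : int) : vanish_above f M -> vanish_above g N ->
  dmul f g (M + N) = f M * g N.
Proof.
move=> fM gN; rewrite -[g in LHS](subrK (lmono N (g N))) dmulDr Defs.coefD.
rewrite (dmul_vanish fM (vanish_sub_leading gN)) ?add0r; last by lia.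
rewrite (@dmul_lmono _ M _ _ _ 1)//; last by lia.
by rewrite big_ord1 lam0 (ratr_nat _ 1) mul1r mul0r addr0/= addrK.
Qed.

Lemma dmul_deg f g : deg (dmul f g) = (deg f + deg g)%E.
Proof.
have [->|f0] := eqVneq f 0; first by rewrite dmul0l deg0; case: deg.
have [->|g0] := eqVneq g 0; first by rewrite dmul0r deg0; case: deg.
have [[k fk] [l gl]] := (is_deg_ex f0, is_deg_ex g0).
rewrite ((degP f k).2 fk) ((degP g l).2 gl) -EFinD; apply/degP; split.
  rewrite (dmul_leading fk.2 gl.2); exact: mulf_neq0 fk.1 gl.1.
exact: dmul_vanish fk.2 gl.2.
Qed.

Lemma dmul_continuous : continuous (fun p : laurent L * laurent L => dmul p.1 p.2).
Proof.
move=> [f g] U /nbhs_laurentP[m mU].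
have [[M0 fM0] [N0 gN0]] := (coefP f, coefP g).
(* Errors of degree at most [a] stay at or below [m] after multiplication, and a <= N0 keeps g'
   within the bound of g. *)
pose a := Num.min (m - Num.max M0 N0) (Num.min M0 N0).
exists ([set f' | vanish_above (f - f') a], [set g' | vanish_above (g - g') a]) => /=.
  by split; apply/nbhs_laurentP; exists a.
move=> [f' g'] [/= ff gg]; apply: mU.
have -> : dmul f g - dmul f' g' = dmul f (g - g') + dmul (f - f') g'.
  by rewrite dmulDr dmulDl dmulNr dmulNl addrA subrK.
have g'N : vanish_above g' N0.
  rewrite -[g'](subKr g); apply: vanish_aboveD => //.
  by move=> i i0; rewrite Defs.coefN gg ?oppr0//; rewrite /a; lia.
apply: vanish_aboveD.
  by apply: vanish_above_le (dmul_vanish fM0 gg); rewrite /a; lia.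
by apply: vanish_above_le (dmul_vanish ff g'N); rewrite /a; lia.
Qed.

Lemma dmul_right_deformed : right_deformed dmul.
Proof.
split; [exact: dmulA|exact: dmulDl|exact: dmulDr|exact: dmul_continuous
  |exact: dmul_scale|exact: dmul_Tpow|exact: dmul1l|exact: dmul1r|exact: dmul_deg].
Qed.

(** * Products as convergent sums *)

Lemma dmul_lmono_series (i j : int) a b :
  series (fun k : nat => lmono (j - k%:Z * nu + i)
            (q2L (lam j k) * iter k D a * b)) n
    @[n --> \oo] --> dmul (lmono i a) (lmono j b).
Proof.
move=> U /nbhs_laurentP[m mU]; exists `|(i + j - m)%R|%N => // n /= n0.
apply: mU; rewrite /series/= big_mkord.
by apply: vanish_above_le (@dmul_monos_tail i j a b n); lia.
Qed.

Lemma dmul_sums_to f g :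
  sums_to (fun p : int * int => dmul (lmono p.1 (f p.1)) (lmono p.2 (g p.2)))
    (dmul f g).
Proof.
move=> U /nbhs_laurentP[m mU].
have [[M fM] [N gN]] := (coefP f, coefP g).
(* A pair outside the square with i <= M and j <= N satisfies i + j <= M + N - Q <= m. *)
pose Q := `|(M + N - m)%R|%N.
pose Fs := [seq (M - q%:Z, N - q'%:Z) | q <- iota 0 Q, q' <- iota 0 Q].
pose u (p : int * int) := dmul (lmono p.1 (f p.1)) (lmono p.2 (g p.2)).
have uFs : uniq Fs.
  apply: allpairs_uniq; rewrite ?iota_uniq// => -[q k] [q' k'] _ _ /= [qq kk].
  by congr pair; lia.
exists [fset p | p in Fs]%fset => // S /= FS; apply: mU.
rewrite /summability.partial_sum -(big_seq_fsetE _ _ xpredT u)/=.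
(* The finite set [S] splits into the square and pairs whose products vanish above [m]. *)
rewrite (bigID (mem Fs))/= opprD addrA.
have -> : \sum_(p <- S | p \in Fs) u p = \sum_(p <- Fs) u p.
  rewrite -big_filter; apply: perm_big; apply: uniq_perm => //.
    by rewrite filter_uniq// fset_uniq.
  move=> p; rewrite mem_filter; apply: andb_idr => pF.
  by move/fsubsetP: FS; apply; rewrite !inE.
apply: vanish_aboveD; last first.
  move=> i mi; rewrite Defs.coefN; apply/eqP; rewrite oppr_eq0; apply/eqP.
  move: i mi; apply: vanish_above_sum => -[i j] ijF; rewrite /u/=.
  have [Mi|iM] := ltP M i; first by rewrite fM// lmono0 dmul0l.
  have [Nj|jN] := ltP N j; first by rewrite gN// lmono0 dmul0r.
  apply: vanish_above_le (dmul_vanish (@lmono_vanish _ _ _) (@lmono_vanish _ _ _)).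
  rewrite leNgt; apply: contra ijF => mij; apply/allpairsP.
  exists (`|(M - i)%R|%N, `|(N - j)%R|%N); rewrite !mem_iota /Q /=.
  by split; [lia|lia|congr pair; lia].
(* The sum over the square is the product of these two truncations. *)
pose f1 := \sum_(q < Q) lmono (M - q%:Z) (f (M - q%:Z)).
pose g1 := \sum_(q < Q) lmono (N - q%:Z) (g (N - q%:Z)).
have -> : \sum_(p <- Fs) u p = dmul f1 g1.
  have iotaE : iota 0 Q = index_iota 0 Q by rewrite /index_iota subn0.
  rewrite /Fs big_allpairs_dep iotaE big_mkord dmul_suml; apply: eq_bigr => q _.
  by rewrite big_mkord dmul_sumr.
have -> : dmul f g - dmul f1 g1 = dmul f (g - g1) + dmul (f - f1) g1.
  by rewrite dmulDr dmulDl dmulNr dmulNl addrA subrK.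
have g1N : vanish_above g1 N.
  apply: vanish_above_sum => q _; apply: vanish_above_le (@lmono_vanish _ _ _); lia.
have fv := laurent_truncate (Q := Q) fM; have gv := laurent_truncate (Q := Q) gN.
apply: vanish_aboveD.
  by apply: vanish_above_le (dmul_vanish fM gv); lia.
by apply: vanish_above_le (dmul_vanish fv g1N); lia.
Qed.

End Product.

Theorem corollary4p9 (K : fieldType) (charK : [pchar K] =i pred0)
    (r s nu : int) (r_neq0 : r != 0) (nuE : nu = r + s) (nu_gt0 : 0 < nu) :
  (forall (i : int) (a b : ratfun K), i <= 0 ->
    eta r nu i (a * b) =
      a * eta r nu i b + eta r nu i a * b +
      \sum_(p \in eta_index i)
        ratr (qbin p.1%:~R (size p.2)) * eta r nu p.1 a
        * foldr (eta r nu (K:=K)) b p.2)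
  /\
  exists mul : laurent (ratfun K) -> laurent (ratfun K) -> laurent (ratfun K),
    [/\ right_deformed mul,
        forall f : ratfun K,
          mul (Tpow 1) (lconst f) +
            series (fun k : nat => mul (Tpow (1 - k.+1%:Z * nu))
                      (lconst (eta r nu (1 - k.+1%:Z * nu) f))) n
          @[n --> \oo] --> mul (lconst f) (Tpow 1),
        forall f : ratfun K,
          mul (Tpow (1 - nu)) (lconst (eta r nu (1 - nu) f)) =
            lmono (1 - nu) (ratr r%:~R^-1 * ratder f)
          /\
          mul (Tpow (1 - 2 * nu)) (lconst (eta r nu (1 - 2 * nu) f)) =
            lmono (1 - 2 * nu)
              (ratr (1 / 2`!%:R * ((1 - nu%:~R) / r%:~R ^+ 2)) *
               ratder (ratder f)),
        forall f g : laurent (ratfun K),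
          sums_to (fun p : int * int =>
                     mul (lmono p.1 (f p.1)) (lmono p.2 (g p.2)))
                  (mul f g)
      & forall (i j : int) (a b : ratfun K),
          series (fun k : nat => lmono (j - k%:Z * nu + i)
                    (ratr (lam r nu j k) * iter k (@ratder K) a * b)) n
          @[n --> \oo] --> mul (lmono i a) (lmono j b)].
Proof.
pose mul := @dmul K r nu nu_gt0.
have mulT (i : int) (x : ratfun K) : mul (Tpow i) (lconst x) = lmono i x.
  by rewrite /mul dmul_scale// rscale_lmono mul1r.
split=> [i a b i0|]; first exact: eta_product.
exists mul; split.
- exact: dmul_right_deformed.
- move=> f U /dmul_lmono_series[N _ NU]; exists N => // n Nn.
  (* One term more is taken, since the summand k = 0 is the separate term T f of the statement. *)
  have := NU n.+1 (leqW Nn); rewrite /series/= !big_mkord big_ord_recl.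
  set x := _ + _; set y := _ + _; suff -> : x = y by [].
  congr (_ + _).
    by rewrite mulT lam0 (ratr_nat _ 1) mul1r mulr1 mul0r addr0 subr0.
  by apply: eq_bigr => k _; rewrite mulT eta_lam// mulr1 addr0.
- move=> f; have r0 : r%:~R != 0 :> rat by rewrite intr_eq0.
  have n0 : nu%:~R != 0 :> rat by rewrite intr_eq0 gt_eqF.
  (* What remains is d'_1 / 1! = 1 / r and d'_2 / 2! = (1 - nu) / (2 r^2). *)
  rewrite !mulT; split; congr lmono.
    have -> : 1 - nu = 1 - 1%N%:Z * nu by rewrite mul1r.
    rewrite etaE//=; congr (ratr _ * _).
    rewrite /dcoef big_ord1 expr1 (_ : 1`! = 1%N)// subr0 divr1.
    by field; rewrite r0 n0.
  have -> : 1 - 2 * nu = 1 - 2%N%:Z * nu by [].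
  rewrite etaE//=; congr (ratr _ * _).
  rewrite /dcoef 2!big_ord_recl big_ord0 (_ : 2`! = 2%N)//= /bump/= addn0.
  by field; rewrite r0 n0.
- exact: dmul_sums_to.
exact: dmul_lmono_series.
Qed.
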